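(* Let $m\ge 0$ be an integer, let $M:=\binom{m+1}{2}$, and let $\mu=(\mu_1,\ldots,\mu_k)$ be a strict partition with $\mu_1>\cdots>\mu_k>m$. Then $$\sum_{\lambda\subseteq[m]} g^{\mu\cup\lambda}\,g^{\mu\cup\lambda^c}=g^{\mu\cup[m]}\,g^{\mu}\cdot\frac{(M+2|\mu|+1)!\,|\mu|!}{(M+|\mu|)!\,(2|\mu|+1)!},$$ where the sum runs over all strict partitions $\lambda$ (including the empty one) all of whose parts lie in $\{1,\ldots,m\}$, and $\lambda^c$ denotes the strict partition whose set of parts is $\{1,\ldots,m\}$ minus the set of parts of $\lambda$.
   Context: A strict partition $\lambda=(\lambda_1>\lambda_2>\cdots>\lambda_\ell>0)$ has size $|\lambda|=\sum\lambda_i$; its shifted diagram consists of the cells $(i,j)$ with $1\le i\le\ell$ and $i\le j\le \lambda_i+i-1$ (row $i$ has $\lambda_i$ cells and is indented $i-1$ places). A standard Young tableau (SYT) of shifted shape $\lambda$ is a filling of the cells by $1,\ldots,|\lambda|$, each used once, increasing along rows (left to right) and down columns (top to bottom). $g^{\lambda}$ denotes the number of such SYT ($g^{\emptyset}=1$). For $m\ge 0$, $[m]:=(m,m-1,\ldots,1)$ is the shifted staircase. For partitions $\alpha,\beta$ where every part of $\alpha$ is at least every part of $\beta$, $\alpha\cup\beta$ denotes their multiset union (a partition whose parts are the parts of $\alpha$ followed by those of $\beta$). *)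

(* Defs.v *)
From mathcomp Require Import all_boot all_order all_algebra.

Set Implicit Arguments.
Unset Strict Implicit.
Unset Printing Implicit Defensive.

Import GRing.Theory Num.Theory.

Definition strict_partition (la : seq nat) : bool :=
  sorted gtn la && all (fun p => 0 < p) la.

(* Rows and columns are numbered from 0: row i occupies the columns
   i, i + 1, ..., i + la_i - 1. *)
Definition shifted_cells (la : seq nat) : seq (nat * nat) :=
  [seq (i, j) | i <- iota 0 (size la), j <- iota i (nth 0 la i)].

Definition cell (la : seq nat) : finType := seq_sub (shifted_cells la).

Definition row la (c : cell la) : nat := (ssval c).1.
Definition col la (c : cell la) : nat := (ssval c).2.

(* The entries are 0, ..., |la| - 1 instead of 1, ..., |la|. *)
Definition filling (la : seq nat) := {ffun cell la -> 'I_(sumn la)}.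

Definition is_SYT la (T : filling la) : bool :=
  [&& [forall k, #|[set c | T c == k]| == 1],
      [forall c, forall d, (row c == row d) && (col c < col d) ==> (T c < T d)]
    & [forall c, forall d, (col c == col d) && (row c < row d) ==> (T c < T d)]].

Definition g (la : seq nat) : nat := #|[set T : filling la | is_SYT T]|.

Definition staircase (m : nat) : seq nat := rev (iota 1 m).

Definition compl_parts (m : nat) (la : seq nat) : seq nat :=
  [seq p <- staircase m | p \notin la].

(* The parts of a bounded sequence over 'I_m.+1, as natural numbers.  A strict
   partition with all parts in {1, ..., m} has at most m parts, so such
   partitions are exactly the [parts s], s : m.-bseq 'I_m.+1, that satisfy
   [strict_partition]. *)
Definition parts (m : nat) (s : m.-bseq 'I_m.+1) : seq nat :=
  [seq nat_of_ord p | p <- s].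

(* Main.v *)
(* Write N = |mu| and M = |[m]|.  Deleting the cell of the largest entry gives the
   recursion for g, and Lagrange interpolation turns it into Schur's formula
     g(la) = |la|! / prod la_i! * prod_(i < j) (la_i - la_j) / (la_i + la_j).
   By this formula g(mu U la) is g(mu) g(la) 'C(N + |la|, N) times a product over
   the parts of la, so g(mu U la) g(mu U la^c) depends on la only through |la| and
   g(la) g(la^c).  For fixed |la| the numbers g(la) g(la^c) add up to g([m]), since
   g(la^c) also counts the chains of shifted shapes from la to [m].  What remains is
   sum_s 'C(N + s, N) 'C(N + M - s, N) = 'C(M + 2N + 1, M). *)
Require Import Defs.
From mathcomp Require Import all_boot all_order all_algebra.
From mathcomp Require Import zify ring lra.

Set Implicit Arguments.
Unset Strict Implicit.
Unset Printing Implicit Defensive.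

Import Order.TTheory GRing.Theory Num.Theory.

(** * Words of cells compatible with rows and columns *)

(** The tableau conditions do not force c to come after d. In this negative form the relation also
    holds between a cell and itself. *)
Definition not_after (c d : nat * nat) : bool :=
  ~~ ((d.1 == c.1) && (d.2 < c.2) || (d.2 == c.2) && (d.1 < c.1)).

(* A tableau is encoded by the word of its cells in the order of their entries. *)
Definition growth_words (s : seq (nat * nat)) : seq (seq (nat * nat)) :=
  [seq w <- permutations s | pairwise not_after w].

Lemma growth_words_uniq s : uniq (growth_words s).
Proof. by rewrite filter_uniq // permutations_uniq. Qed.

Lemma mem_growth_words s w :
  (w \in growth_words s) = pairwise not_after w && perm_eq w s.
Proof. by rewrite mem_filter mem_permutations. Qed.

Lemma perm_size_growth_words s t :
  perm_eq s t -> size (growth_words s) = size (growth_words t).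
Proof.
move=> st; apply: perm_size; apply: uniq_perm; rewrite ?growth_words_uniq //.
by move=> w; rewrite !mem_growth_words (permPr st).
Qed.

(** Classify the words by their last letter c: it can be any cell of s that no cell of s is forced
    to follow, and deleting it leaves a word of the same kind. *)
Lemma size_growth_words_rec s : uniq s -> s != [::] ->
  size (growth_words s)
    = \sum_(c <- s | all (not_after^~ c) s) size (growth_words (rem c s)).
Proof.
move=> us sn0; rewrite -big_filter.
pose f c := [seq rcons w c | w <- growth_words (rem c s)].
transitivity (size (flatten [seq f c | c <- s & all (not_after^~ c) s])); last first.
  rewrite size_flatten /shape -map_comp sumnE big_map.
  by apply: eq_bigr => c _; rewrite /= size_map.
apply/perm_size/uniq_perm; first exact: growth_words_uniq.
- apply: allpairs_uniq_dep => [|c _|[c w] [d v] _ _ /= /rcons_inj[-> ->]] //.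
    exact: filter_uniq.
  exact: growth_words_uniq.
move=> w; apply/idP/idP.
- case/lastP: w => [|w c]; rewrite mem_growth_words => /andP[].
    by move=> _ /perm_size /esym /eqP; rewrite size_eq0 (negPf sn0).
  rewrite pairwise_rcons => /andP[alc pw] ps.
  have cs : c \in s by rewrite -(perm_mem ps) mem_rcons mem_head.
  apply/allpairsPdep; exists c, w; split=> //; last first.
    rewrite mem_growth_words pw /=.
    by rewrite -(perm_cons c) -(permPr (perm_to_rem cs)) -perm_rcons.
  rewrite mem_filter cs andbT -(perm_all _ ps) all_rcons alc andbT.
  by rewrite /not_after !ltnn !andbF.
case/allpairsPdep=> c [v [+ + ->]].
rewrite mem_filter mem_growth_words => /andP[alc cs] /andP[pv ps].
rewrite mem_growth_words pairwise_rcons pv andbT; apply/andP; split.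
  by apply/allP=> x; rewrite (perm_mem ps) => /mem_rem; move/allP: alc; exact.
by rewrite perm_rcons (permPr (perm_to_rem cs)) perm_cons.
Qed.

(** * The cells of a shifted diagram *)

Lemma shifted_cells_uniq la : uniq (shifted_cells la).
Proof.
by apply: allpairs_uniq_dep => [|i _|[i j] [k l] _ _ /= [-> ->]//]; apply: iota_uniq.
Qed.

Lemma size_shifted_cells la : size (shifted_cells la) = sumn la.
Proof.
rewrite /shifted_cells size_allpairs_dep.
under eq_map do rewrite size_iota.
by rewrite map_nth_iota0 // take_size.
Qed.

(** Past the last row [nth] gives 0, so the double inequality has no solution there. *)
Lemma mem_shifted_cells la c :
  (c \in shifted_cells la) = (c.1 <= c.2 < c.1 + nth 0 la c.1).
Proof.
case: c => i j; apply/allpairsPdep/idP => /= [[k [l [_ + [-> ->]]]]|ij].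
  by rewrite mem_iota.
exists i, j; rewrite !mem_iota; split=> //=.
by rewrite ltnNge; apply/negP=> h; move: ij; rewrite nth_default //; lia.
Qed.

(** * Standard tableaux and their words *)

Section TableauWords.
Variable la : seq nat.
Implicit Types (T : filling la) (c d : cell la).

Definition tableau_word T : seq (nat * nat) :=
  [seq ssval c | c <- sort (relpre T (fun i j : 'I__ => i <= j)) (enum (cell la))].

Lemma perm_tableau_word T : perm_eq (tableau_word T) (shifted_cells la).
Proof.
apply: (@perm_trans _ (map (@ssval _ _) (enum (cell la)))).
  by apply: perm_map; rewrite perm_sort.
apply: uniq_perm.
- by rewrite (map_inj_uniq val_inj) enum_uniq.
- exact: shifted_cells_uniq.
move=> c; apply/mapP/idP => [[x _ ->]|h]; first exact: valP x.
by exists (SeqSub h); rewrite ?mem_enum.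
Qed.

Lemma card_cell : #|cell la| = sumn la.
Proof. by rewrite card_seq_sub ?shifted_cells_uniq // size_shifted_cells. Qed.

(** The sorted entries are [sumn la] distinct numbers below [sumn la], hence 0, 1, 2, ... in order;
    so a filling can be read off its word. *)
Lemma index_tableau_word T c : injective T -> index (ssval c) (tableau_word T) = T c.
Proof.
move=> iT; rewrite /tableau_word; set s := sort _ _.
have ps : perm_eq s (enum (cell la)) by rewrite perm_sort.
have us : uniq s by rewrite (perm_uniq ps) enum_uniq.
have cs : c \in s by rewrite (perm_mem ps) mem_enum.
rewrite index_map; last exact: val_inj.
have E : [seq val (T c) | c <- s] = iota 0 (sumn la).
  apply: (sorted_eq leq_trans anti_leq).
  - by rewrite sorted_map; apply: sort_sorted => x y /=; apply: leq_total.
  - exact: iota_sorted.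
  apply: uniq_perm; first by rewrite map_inj_uniq // => x y /val_inj/iT.
    exact: iota_uniq.
  refine (uniq_min_size _ _ _).2.
  - by rewrite map_inj_uniq // => x y /val_inj/iT.
  - by move=> _ /mapP[x _ ->]; rewrite mem_iota /=.
  by rewrite size_map size_iota (perm_size ps) -cardE card_cell.
have := congr1 (fun t => nth 0 t (index c s)) E.
rewrite (nth_map c) ?index_mem // nth_index // nth_iota //.
by rewrite -card_cell cardE -(perm_size ps) index_mem.
Qed.

Lemma SYT_inj T : is_SYT T -> injective T.
Proof.
case/and3P=> /forallP h _ _ x y exy.
have /cards1P[z E] := h (T x).
have : x \in [set c | T c == T x] by rewrite inE.
have : y \in [set c | T c == T x] by rewrite inE exy.
by rewrite E !inE => /eqP -> /eqP ->.
Qed.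

(** Entries are positions in the word, so the row and column conditions compare positions. Each
    entry occurs once because there are as many cells as entries. *)
Lemma inj_SYT T : injective T -> is_SYT T = pairwise not_after (tableau_word T).
Proof.
move=> iT; set w := tableau_word T.
have pw := perm_tableau_word T.
have uw : uniq w by rewrite (perm_uniq pw) shifted_cells_uniq.
apply/idP/idP=> [/and3P[_ /forallP hr /forallP hc]|/(pairwiseP (0, 0)) hw].
  apply/(pairwiseP (0, 0)) => i j; rewrite !inE => iw jw ij.
  have mem k : k < size w -> {c : cell la | ssval c = nth (0, 0) w k}.
    move=> kw; have h : nth (0, 0) w k \in shifted_cells la.
      by rewrite -(perm_mem pw) mem_nth.
    by exists (SeqSub h).
  have [c ec] := mem i iw; have [d ed] := mem j jw.
  have Tc : T c = i :> nat by rewrite -index_tableau_word // ec index_uniq.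
  have Td : T d = j :> nat by rewrite -index_tableau_word // ed index_uniq.
  rewrite -ec -ed; apply/negP=> /orP H.
  have : T d < T c.
    case: H => H; first by have /forallP/(_ c)/implyP := hr d; apply.
    by have /forallP/(_ c)/implyP := hc d; apply.
  by rewrite Tc Td ltnNge (ltnW ij).
have key c d : ~~ not_after (ssval d) (ssval c) -> T c < T d.
  rewrite ltnNge; apply: contraNN; rewrite leq_eqVlt => /orP[/eqP/val_inj/iT ->|].
    by rewrite /not_after !ltnn !andbF.
  have cw (x : cell la) : ssval x \in w by rewrite (perm_mem pw); apply: ssvalP.
  rewrite -!index_tableau_word // -/w => lt.
  have := hw (index (ssval d) w) (index (ssval c) w).
  by rewrite !inE !index_mem !cw !nth_index //; apply.
apply/and3P; split.
- have bT : bijective T.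
    by apply: inj_card_bij => //; rewrite card_ord card_cell.
  have [h Th hT] := bT; apply/forallP=> k; apply/cards1P; exists (h k).
  apply/setP=> c; rewrite !inE; apply/eqP/eqP => [<-|->]; by rewrite ?Th ?hT.
- apply/forallP=> c; apply/forallP=> d; apply/implyP=> H.
  by apply: key; rewrite /not_after negbK; apply/orP; left.
apply/forallP=> c; apply/forallP=> d; apply/implyP=> H.
by apply: key; rewrite /not_after negbK; apply/orP; right.
Qed.

Lemma g_growth_words : g la = size (growth_words (shifted_cells la)).
Proof.
rewrite /g cardE -(size_map tableau_word).
apply/perm_size/uniq_perm; last 1 first.
- move=> w; apply/mapP/idP => [[T + ->]|].
    rewrite mem_enum inE mem_growth_words perm_tableau_word andbT => ST.
    by rewrite -inj_SYT //; apply: SYT_inj.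
  rewrite mem_growth_words => /andP[pw ps].
  have uw : uniq w by rewrite (perm_uniq ps) shifted_cells_uniq.
  have cw (c : cell la) : ssval c \in w by rewrite (perm_mem ps); apply: ssvalP.
  have lt (c : cell la) : index (ssval c) w < sumn la.
    by rewrite -size_shifted_cells -(perm_size ps) index_mem.
  (* The inverse encoding: the entry of a cell is its position in the word. *)
  pose T : filling la := [ffun c => Ordinal (lt c)].
  have TE c : T c = index (ssval c) w :> nat by rewrite ffunE.
  have iT : injective T.
    move=> c d /(congr1 (@nat_of_ord _)); rewrite !TE => e; apply: val_inj => /=.
    by rewrite -(nth_index (0, 0) (cw c)) e nth_index.
  have pT := perm_tableau_word T.
  have E : w = tableau_word T.
    apply: (@eq_from_nth _ (0, 0)) => [|i iw].
      by rewrite (perm_size ps) (perm_size pT).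
    have hm : nth (0, 0) w i \in shifted_cells la by rewrite -(perm_mem ps) mem_nth.
    have := index_tableau_word (SeqSub hm) iT; rewrite TE /= index_uniq // => e.
    by rewrite -{2}e nth_index // (perm_mem pT).
  by exists T => //; rewrite mem_enum inE inj_SYT // -E.
- rewrite map_inj_in_uniq ?enum_uniq // => T U.
  rewrite !mem_enum !inE => /SYT_inj iT /SYT_inj iU e.
  apply/ffunP=> c; apply: ord_inj.
  by rewrite -(index_tableau_word c iT) -(index_tableau_word c iU) e.
exact: growth_words_uniq.
Qed.

End TableauWords.

(** * Corners of a shifted diagram and the recursion for [g] *)

Implicit Types (la : seq nat) (p : nat).

(** Deletes the last cell of the row of length p; a part 1 becomes 0 and is dropped. *)
Definition decr p la : seq nat :=
  [seq x <- [seq if x == p then p.-1 else x | x <- la] | 0 < x].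

Lemma gtn_trans : transitive gtn.
Proof. by move=> y x z /= xy yz; apply: ltn_trans yz xy. Qed.

Lemma strict_partition_uniq la : strict_partition la -> uniq la.
Proof.
by case/andP=> sl _; apply: sorted_uniq sl; [apply: gtn_trans | move=> x /=; rewrite ltnn].
Qed.

Lemma strict_partition_gt0 la p : strict_partition la -> p \in la -> 0 < p.
Proof. by case/andP=> _ /allP; apply. Qed.

Lemma strict_partition_eq la mu : strict_partition la -> strict_partition mu ->
  la =i mu -> la = mu.
Proof.
case/andP=> sl _ /andP[sm _]; apply: irr_sorted_eq sl sm; first exact: gtn_trans.
by move=> x /=; rewrite ltnn.
Qed.

(** Strict parts drop by at least one per row; equivalently, the right ends of the shifted rows move
    weakly left going down. *)
Lemma nth_strict_partition la i j : strict_partition la ->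
  i <= j < size la -> nth 0 la j + (j - i) <= nth 0 la i.
Proof.
case/andP=> sl _ /andP[/subnKC <-]; set d := j - i; rewrite addKn.
elim: d => [|d IH] lt; first by rewrite !addn0.
have := @sorted_ltn_nth _ gtn gtn_trans 0 la sl (i + d) (i + d.+1).
rewrite !inE; move: lt IH; rewrite addnS => lt IH /(_ (ltnW lt) lt (ltnSn _)) /=.
by have := IH (ltnW lt); lia.
Qed.

Lemma map_decr_sorted la p : strict_partition la -> p.-1 \notin la ->
  sorted gtn [seq if x == p then p.-1 else x | x <- la].
Proof.
move=> sla npl; have /andP[sl _] := sla.
apply: homo_sorted_in (allss la) sl => x y xl yl /= yx.
have : y != p.-1 by apply: contraNneq npl => <-.
by move/eqP; do 2!case: (_ =P p); lia.
Qed.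

Lemma strict_partition_decr la p : strict_partition la -> p.-1 \notin la ->
  strict_partition (decr p la).
Proof.
move=> sla npl; rewrite /strict_partition /decr filter_all andbT.
by apply: sorted_filter; [apply: gtn_trans | apply: map_decr_sorted].
Qed.

Lemma mem_decr la p x : p \in la ->
  (x \in decr p la) = (0 < x) && ((x == p.-1) || (x != p) && (x \in la)).
Proof.
move=> pl; rewrite mem_filter; case: ltnP => //= x0; apply/mapP/idP.
  by case=> y yl ->; case: (eqVneq y p) => [_|->]; rewrite ?eqxx // yl orbT.
case/orP=> [/eqP->|/andP[xp xl]]; first by exists p; rewrite ?eqxx.
by exists x; rewrite // (negPf xp).
Qed.

(** A zero can only be the last entry, and there [nth] returns 0 by default once it is dropped. *)
Lemma nth_filter_gt0 (la : seq nat) i : sorted gtn la ->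
  nth 0 [seq x <- la | 0 < x] i = nth 0 la i.
Proof.
elim: la i => // x la IH i /= pth; have sl := path_sorted pth.
case: ltnP => [_|]; first by case: i => [|i] //=; apply: IH.
rewrite leqn0 => /eqP x0; move: pth; rewrite x0.
by case: (la) => [|y l] //=; case: i => [|[]].
Qed.

Lemma nth_decr la p i : strict_partition la -> p \in la -> p.-1 \notin la ->
  nth 0 (decr p la) i = nth 0 la i - (i == index p la).
Proof.
move=> sla pl npl; have p0 := strict_partition_gt0 sla pl.
rewrite nth_filter_gt0; last exact: map_decr_sorted.
have [il|il] := ltnP i (size la); last first.
  by rewrite !nth_default ?size_map.
rewrite (nth_map 0) //; case: (eqVneq i (index p la)) => [->|ne].
  by rewrite nth_index // eqxx subn1.
case: eqP => [e|_]; last by rewrite subn0.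
by case/eqP: ne; rewrite -e index_uniq // strict_partition_uniq.
Qed.

(** Row i starts in column i, so a row of length p ends in column i + p - 1. *)
Definition corner la p : nat * nat := (index p la, (index p la + p).-1).

(** A cell that no other must follow ends its row and has nothing below it. The row under a row of
    length p reaches the end column of that row exactly when its length is p - 1. *)
Lemma maximal_cellP la c : strict_partition la ->
  reflect (exists p, [/\ p \in la, p.-1 \notin la & c = corner la p])
    ((c \in shifted_cells la) && all (not_after^~ c) (shifted_cells la)).
Proof.
move=> sla; have ula := strict_partition_uniq sla.
apply: (iffP andP) => [[]|[p [pl npl ->]]].
  case: c => i j; rewrite mem_shifted_cells /= => /andP[ij jl] /allP H.
  have il : i < size la.
    by rewrite ltnNge; apply/negP=> h; move: jl; rewrite nth_default //; lia.
  have jE : j = (i + nth 0 la i).-1.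
    apply/eqP; rewrite eqn_leq; apply/andP; split; first lia.
    rewrite leqNgt; apply/negP=> h.
    have /H : (i, j.+1) \in shifted_cells la by rewrite mem_shifted_cells /=; lia.
    by rewrite /not_after /= eqxx ltnSn.
  exists (nth 0 la i); rewrite mem_nth //; split=> //; last first.
    by rewrite /corner index_uniq // jE.
  (* A part smaller by one would be the next row, and that row would contain the cell below c. *)
  apply/negP=> pl; set k := index (nth 0 la i).-1 la.
  have kl : k < size la by rewrite index_mem.
  have kE : nth 0 la k = (nth 0 la i).-1 by apply: nth_index.
  have ik : i < k.
    rewrite ltnNge; apply/negP=> ki.
    by have := nth_strict_partition sla (_ : k <= i < size la); rewrite ki il kE; lia.
  have lk := nth_strict_partition sla (_ : i <= k < size la).
  rewrite kl (ltnW ik) in lk; have {}lk := lk isT.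
  have pk := strict_partition_gt0 sla pl.
  have /H : (k, j) \in shifted_cells la by rewrite mem_shifted_cells /=; lia.
  by rewrite /not_after /= eqxx ik orbT.
have p0 := strict_partition_gt0 sla pl.
have il : index p la < size la by rewrite index_mem.
split; first by rewrite mem_shifted_cells /corner /= nth_index //; lia.
apply/allP=> -[k j]; rewrite mem_shifted_cells /not_after /corner /= => /andP[kj jl].
have kl : k < size la.
  by rewrite ltnNge; apply/negP=> h; move: jl; rewrite nth_default //; lia.
apply/negP=> /orP[/andP[/eqP ek]|/andP[/eqP ej ik]].
  by move: jl; rewrite -ek nth_index //; lia.
(* If row k reaches the column of the corner, the parts from p down to row k drop by exactly one
   each time, so p - 1 is a part. *)
have := nth_strict_partition sla (_ : index p la <= k < size la).
rewrite kl (ltnW ik) nth_index // => /(_ isT) h.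
case/negP: npl; rewrite (_ : p.-1 = nth 0 la (index p la).+1); last first.
  have := nth_strict_partition sla (_ : index p la <= (index p la).+1 < size la).
  have := nth_strict_partition sla (_ : (index p la).+1 <= k < size la).
  rewrite kl ik nth_index // leqnSn (leq_ltn_trans ik kl) => /(_ isT) h1 /(_ isT) h2.
  by lia.
by apply: mem_nth; apply: leq_ltn_trans kl.
Qed.

(** The largest entry occupies a corner as in [maximal_cellP], and the remaining cells form the
    diagram of [decr p la]. *)
Lemma g_rec la : strict_partition la -> la != [::] ->
  g la = \sum_(p <- la | p.-1 \notin la) g (decr p la).
Proof.
move=> sla lan0; have ula := strict_partition_uniq sla.
have ucl := shifted_cells_uniq la.
rewrite g_growth_words size_growth_words_rec //; last first.
  rewrite -size_eq0 size_shifted_cells; case: la sla lan0 {ula ucl} => //= x l.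
  by case/andP=> _ /= /andP[]; lia.
rewrite -big_filter -[RHS]big_filter.
rewrite (perm_big [seq corner la p | p <- la & p.-1 \notin la]) /=; last first.
  apply: uniq_perm; first exact: filter_uniq.
    rewrite map_inj_in_uniq ?filter_uniq // => p q.
    rewrite !mem_filter => /andP[_ pl] /andP[_ ql] [e _].
    by rewrite -(nth_index 0 pl) e nth_index.
  move=> c; rewrite mem_filter andbC; apply/maximal_cellP/mapP => //.
    by case=> p [pl npl ->]; exists p; rewrite // mem_filter npl.
  by case=> p; rewrite mem_filter => /andP[npl pl] ->; exists p.
rewrite big_map; apply: eq_big_seq => p; rewrite mem_filter => /andP[npl pl].
rewrite g_growth_words; apply: perm_size_growth_words.
apply: uniq_perm; rewrite ?rem_uniq ?shifted_cells_uniq // => -[i j].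
rewrite (mem_rem_uniq _ ucl) inE !mem_shifted_cells nth_decr //= xpair_eqE.
have p0 := strict_partition_gt0 sla pl.
case: (eqVneq i (index p la)) => [->|_] /=; last by rewrite subn0.
by rewrite nth_index //; lia.
Qed.

Lemma g_nil : g [::] = 1.
Proof. by rewrite g_growth_words. Qed.

Lemma sumn_decr (la : seq nat) (p : nat) : strict_partition la -> p \in la ->
  sumn la = (sumn (decr p la)).+1.
Proof.
move=> sla pl; have ula := strict_partition_uniq sla.
have p0 := strict_partition_gt0 sla pl.
have -> : sumn (decr p la) = \sum_(x <- la) (if x == p then p.-1 else x).
  rewrite sumnE big_filter big_mkcond big_map.
  by apply: eq_bigr => x _; case: ltnP => //; rewrite leqn0 => /eqP.
rewrite sumnE !(bigD1_seq p) //= eqxx -addSn prednK //; congr (_ + _).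
by apply: eq_bigr => x /negPf ->.
Qed.

(** * Strict partitions inside the staircase as subsets *)

Lemma mem_staircase (m p : nat) : (p \in staircase m) = (0 < p <= m).
Proof. by rewrite mem_rev mem_iota add1n ltnS. Qed.

Lemma strict_partition_staircase (m : nat) : strict_partition (staircase m).
Proof.
rewrite /strict_partition; apply/andP; split.
  by rewrite /staircase rev_sorted; apply: iota_ltn_sorted.
by apply/allP=> p; rewrite mem_staircase => /andP[].
Qed.

Lemma strict_partition_filter (P : pred nat) (la : seq nat) :
  strict_partition la -> strict_partition (filter P la).
Proof.
case/andP=> sl al; rewrite /strict_partition (sorted_filter gtn_trans) //=.
by apply/allP=> p; rewrite mem_filter => /andP[_]; move/allP: al; apply.
Qed.

Lemma sumn_staircase (m : nat) : sumn (staircase m) = 'C(m.+1, 2).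
Proof. by rewrite -bin2_sum big_ltn // add0n sumn_rev sumnE /index_iota subn1. Qed.

Section SetPartitions.
Variable m : nat.
Implicit Types (A B : {set 'I_m}) (i : 'I_m).

(* The index [i] of ['I_m] stands for the part [i.+1]. *)
Definition set_parts A : seq nat :=
  [seq p <- staircase m | [exists i in A, p == i.+1]].

Lemma set_partsP A (p : nat) : reflect (exists2 i, i \in A & p = i.+1) (p \in set_parts A).
Proof.
rewrite mem_filter mem_staircase; apply: (iffP andP) => [[/exists_inP[i iA /eqP ->] _]|].
  by exists i.
by case=> i iA ->; rewrite ltn_ord; split=> //; apply/exists_inP; exists i.
Qed.

Lemma mem_set_parts A i : (i.+1 \in set_parts A) = (i \in A).
Proof. by apply/set_partsP/idP => [[j jA [/ord_inj ->]]|iA] //; exists i. Qed.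

Lemma strict_partition_set_parts A : strict_partition (set_parts A).
Proof. exact/strict_partition_filter/strict_partition_staircase. Qed.

Lemma compl_set_parts A : compl_parts m (set_parts A) = set_parts (~: A).
Proof.
apply: eq_in_filter => -[|p]; rewrite mem_staircase //= => pm.
rewrite (mem_set_parts A (Ordinal pm)).
apply/idP/exists_inP => [nA|[i + /eqP[e]]]; first by exists (Ordinal pm); rewrite ?inE.
by rewrite (_ : Ordinal pm = i) ?inE //; apply: ord_inj.
Qed.

Lemma set_parts0 : set_parts set0 = [::].
Proof.
rewrite /set_parts (eq_filter (a2 := pred0)) ?filter_pred0 // => p.
by apply/exists_inP => -[i]; rewrite inE.
Qed.

Lemma set_partsT : set_parts setT = staircase m.
Proof.
apply/all_filterP/allP=> -[|p]; rewrite mem_staircase //= => pm.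
by apply/exists_inP; exists (Ordinal pm); rewrite ?inE.
Qed.

Lemma perm_set_parts_setC A :
  perm_eq (set_parts A ++ set_parts (~: A)) (staircase m).
Proof.
rewrite -compl_set_parts perm_sym -(permPl (permEl (perm_filterC (mem (set_parts A)) _))).
rewrite perm_cat2r (_ : filter _ _ = set_parts A) //.
by apply: eq_in_filter => p pm /=; rewrite mem_filter pm andbT.
Qed.

Definition weight A := sumn (set_parts A).

Lemma weight_setC A : weight A + weight (~: A) = 'C(m.+1, 2).
Proof. by rewrite -sumn_cat (perm_sumn (perm_set_parts_setC A)) sumn_staircase. Qed.

(** Flips the membership of the parts i + 1 and i (only of 1 when i = 0). On removable i this lowers
    the part i + 1; unlike lowering, it is an involution on all sets and commutes with
    complement. *)
Definition toggle i A := [set j | (j \in A) (+) ((j == i) || (j.+1 == i :> nat))].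

Definition removable i A := (i \in A) && (val i \notin set_parts A).

Lemma toggleK i : involutive (toggle i).
Proof. by move=> A; apply/setP=> j; rewrite !inE addbK. Qed.

Lemma toggleC i A : toggle i (~: A) = ~: toggle i A.
Proof. by apply/setP=> j; rewrite !inE addNb. Qed.

(** Toggling and complementing each flip the membership of i + 1 and of i, so together they leave it
    unchanged. *)
Lemma removable_toggleC i A : removable i (~: toggle i A) = removable i A.
Proof.
rewrite /removable !inE eqxx /= addbT negbK; congr (_ && ~~ _).
case: i => -[|k] ki /=; first by apply/set_partsP/set_partsP => -[].
pose j := Ordinal (ltnW ki).
rewrite -[k.+1]/(j.+1) !mem_set_parts !inE /= eqxx orbT addbT negbK //.
Qed.

Lemma decr_set_parts i A : removable i A ->
  decr i.+1 (set_parts A) = set_parts (toggle i A).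
Proof.
case/andP=> iA niA; apply: strict_partition_eq.
- exact: (@strict_partition_decr _ i.+1 (strict_partition_set_parts A) niA).
- exact: strict_partition_set_parts.
move=> x; rewrite mem_decr ?mem_set_parts //=.
case: x => [|x] /=; first by apply/esym/set_partsP => -[].
have [xm|xm] := ltnP x m; last first.
  have nx B : x.+1 \notin set_parts B.
    by apply/negP=> /set_partsP[j _ [e]]; move: (ltn_ord j); rewrite -e ltnNge xm.
  rewrite (negPf (nx A)) (negPf (nx _)) andbF orbF; apply/eqP=> e.
  by move: (ltn_ord i); rewrite -e ltnNge (leq_trans xm).
rewrite -[x.+1]/((Ordinal xm).+1) !mem_set_parts inE -val_eqE /= eqSS.
case: (x.+1 =P i :> nat) => [e|_] /=; last first.
  rewrite orbF; case: eqP => [e|_] /=; last by rewrite addbF.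
  by rewrite (_ : Ordinal xm = i) ?iA //; apply: ord_inj.
move: niA; rewrite -[val i]e -[x.+1]/((Ordinal xm).+1) mem_set_parts => /negPf ->.
by rewrite orbT.
Qed.

Lemma g_set_parts_rec A : A != set0 ->
  g (set_parts A) = \sum_(i | removable i A) g (set_parts (toggle i A)).
Proof.
move=> A0; have sA := strict_partition_set_parts A.
rewrite g_rec //; last first.
  by case/set0Pn: A0 => i; rewrite -mem_set_parts; case: (set_parts A).
transitivity (\sum_(p <- [seq (val i).+1 | i <- enum A] | p.-1 \notin set_parts A)
    g (decr p (set_parts A))).
  apply: perm_big; apply: uniq_perm; first exact: strict_partition_uniq.
    by rewrite map_inj_uniq ?enum_uniq // => i j [] /ord_inj.
  move=> p; apply/set_partsP/mapP => -[i iA ->]; exists i => //; move: iA; by rewrite mem_enum.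
rewrite big_map big_enum_cond /=; apply: eq_bigr => i ri.
by rewrite decr_set_parts.
Qed.

Lemma weight_removable i A : removable i A -> weight A = (weight (toggle i A)).+1.
Proof.
move=> ri; rewrite /weight -decr_set_parts //; apply: sumn_decr.
  exact: strict_partition_set_parts.
by rewrite mem_set_parts; case/andP: ri.
Qed.

(* Complementation reverses the covering relation, so the two sides of a
   standard tableau of staircase shape cut at the shape [set_parts A] are
   counted by A and by its complement. *)
Lemma sum_g_set_parts (s : nat) : s <= 'C(m.+1, 2) ->
  \sum_(A | weight A == s) g (set_parts A) * g (set_parts (~: A)) = g (staircase m).
Proof.
elim: s => [_|s IH sM].
  rewrite (big_pred1 set0) ?set_parts0 ?setC0 ?set_partsT ?g_nil ?mul1n // => A.
  apply/eqP/eqP => [w0|->]; last by rewrite /weight set_parts0.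
  apply/setP=> i; rewrite inE -mem_set_parts; apply/negP=> iA.
  by have := sumn_decr (strict_partition_set_parts A) iA; rewrite -/(weight A) w0.
rewrite -IH; last exact: ltnW.
have nz A : 0 < weight A -> A != set0.
  by apply: contraTneq => ->; rewrite /weight set_parts0.
transitivity (\sum_(A | weight A == s.+1) \sum_(i | removable i A)
    g (set_parts (toggle i A)) * g (set_parts (~: A))).
  by apply: eq_bigr => A /eqP w; rewrite g_set_parts_rec ?nz ?w // big_distrl.
transitivity (\sum_(A | weight A == s) \sum_(i | removable i (~: A))
    g (set_parts A) * g (set_parts (toggle i (~: A)))); last first.
  apply: eq_bigr => A /eqP w; rewrite (@g_set_parts_rec (~: A)) ?big_distrr ?nz //.
  by rewrite -(ltn_add2l s) addn0 -{2}w weight_setC.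
rewrite (exchange_big_dep predT) //= [RHS](exchange_big_dep predT) //=; apply: eq_bigr => i _.
(* For fixed i, substituting [toggle i A] for A turns a step down from a shape of weight s + 1 into
   a step down from the complement of a shape of weight s. *)
rewrite (reindex_inj (inv_inj (toggleK i))) /=.
apply: eq_big => [A|A _]; last by rewrite toggleK toggleC.
rewrite -(removable_toggleC i (~: A)) toggleC setCK.
apply: andb_id2r => rA; rewrite (weight_removable rA) toggleK eqSS //.
Qed.

Lemma sum_bseq_set_parts (F : seq nat -> nat) :
  \sum_(s : m.-bseq 'I_m.+1 | strict_partition (parts s)) F (parts s)
    = \sum_A F (set_parts A).
Proof.
(* The default values of [insub_bseq] and [inord] are not reached: there are at most m parts, each
   at most m. *)
pose h A : m.-bseq 'I_m.+1 := insub_bseq m [seq inord p | p <- set_parts A].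
pose h' (s : m.-bseq 'I_m.+1) : {set 'I_m} := [set i : 'I_m | i.+1 \in parts s].
have hE A : parts (h A) = set_parts A.
  rewrite /parts /h /insub_bseq insubdK; last first.
    rewrite unfold_in size_map size_filter; apply: leq_trans (count_size _ _) _.
    by rewrite size_rev size_iota.
  rewrite -map_comp -[RHS]map_id; apply/eq_in_map => p /set_partsP[i _ ->] /=.
  by rewrite inordK // ltnS.
have parts_inj : injective (@parts m).
  by move=> s t /(inj_map val_inj) /val_inj.
rewrite (reindex_onto h h') => [|s ss]; last first.
  apply: parts_inj; rewrite hE; apply: strict_partition_eq => //.
    exact: strict_partition_set_parts.
  move=> p; apply/set_partsP/idP => [[i + ->]|ps]; first by rewrite inE.
  have p0 := strict_partition_gt0 ss ps.
  have pm : p.-1 < m by case/mapP: ps p0 => q _ ->; have := ltn_ord q; lia.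
  by exists (Ordinal pm); rewrite ?inE /= prednK.
apply: eq_big => [A|A _]; last by rewrite hE.
rewrite hE strict_partition_set_parts; apply/eqP/setP => i.
by rewrite inE hE mem_set_parts.
Qed.

End SetPartitions.

(** * A convolution of binomial coefficients *)

(** The coefficient of x^n in (1 - x)^(-a-1) (1 - x)^(-b-1). The double induction uses Pascal's
    rule, which reduces (b + 1, n + 1) to (b, n + 1) and (b + 1, n). *)
Lemma sum_bin_bin (a b n : nat) :
  \sum_(s < n.+1) 'C(a + s, a) * 'C(b + (n - s), b) = 'C(a + b + n.+1, n).
Proof.
elim: b n => [|b IHb] n.
  under eq_bigr do rewrite bin0 muln1.
  elim: n => [|n IH]; first by rewrite big_ord1 addn0 binn bin0.
  rewrite big_ord_recr /= IH addn0 !addnS binS addnC -addnS.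
  by rewrite -(@bin_sub (a + n.+1) a) ?leq_addr // addKn.
elim: n => [|n IHn]; first by rewrite big_ord1 subnn !addn0 !binn bin0.
rewrite [RHS](_ : _ = 'C(a + b + n.+2, n.+1) + 'C(a + b.+1 + n.+1, n)); last first.
  by rewrite [in LHS]addnS binS; congr ('C(_, _) + _); lia.
rewrite -IHb -IHn [LHS]big_ord_recr [X in _ = X + _]big_ord_recr /=.
rewrite !subnn !addn0 !binn addnAC; congr (_ + _).
rewrite -big_split; apply: eq_bigr => s _ /=.
have sn : s <= n by rewrite -ltnS.
by rewrite subSn // addSn addnS binS mulnDr addnC.
Qed.

(** * Lagrange interpolation *)

Local Open Scope ring_scope.

(** p equals its interpolation polynomial q at the nodes [a x]. Each [l x] is monic of size
    [size s], so the coefficient in question of q is the sum of the [c x]. *)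
Lemma sum_lagrange_coef (F : fieldType) (T : eqType) (s : seq T) (a : T -> F)
    (p : {poly F}) :
  uniq s -> {in s &, injective a} -> (size p <= size s)%N ->
  \sum_(x <- s) p.[a x] / \prod_(y <- s | y != x) (a x - a y)
    = p`_(size s).-1.
Proof.
move=> us ia sp.
pose c x := p.[a x] / \prod_(y <- s | y != x) (a x - a y).
pose l x : {poly F} := \prod_(y <- s | y != x) ('X - (a y)%:P).
pose q := \sum_(x <- s) c x *: l x.
have sl x : x \in s -> size (l x) = size s.
  move=> xs; rewrite /l -big_filter size_prod_XsubC.
  rewrite -rem_filter // size_rem // prednK //.
  by case: (s) xs.
have pq : p = q.
  apply/eqP; rewrite -subr_eq0; apply/eqP.
  apply: (@roots_geq_poly_eq0 _ _ (map a s)).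
  - apply/allP => _ /mapP[x xs ->]; rewrite rootE hornerD hornerN subr_eq0.
    rewrite /q horner_sum (bigD1_seq x) //= big1_seq ?addr0.
      rewrite hornerZ /l horner_prod (eq_bigr (fun y => a x - a y)); last first.
        by move=> y _; rewrite hornerXsubC.
      rewrite /c divfK // prodf_seq_neq0; apply/allP => y ys; apply/implyP => yx.
      by rewrite subr_eq0; apply: contra yx => /eqP/ia ->.
    move=> y /andP[yx ys]; rewrite hornerZ /l horner_prod.
    rewrite (big_rem x) //= eq_sym yx.
    by rewrite hornerXsubC subrr mul0r mulr0.
  - by rewrite map_inj_in_uniq.
  rewrite size_map; apply: leq_trans (size_polyD _ _) _.
  rewrite size_polyN geq_max sp /q; apply: leq_trans (size_sum _ _ _) _.
  apply/bigmax_leqP_seq => x xs _.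
  by apply: leq_trans (size_scale_leq _ _) _; rewrite sl.
rewrite [in RHS]pq /q coef_sum; apply: eq_big_seq => x xs.
have /monicP := monic_prod_XsubC s (fun y => y != x) a.
by rewrite -/(l x) /lead_coef sl // coefZ => ->; rewrite mulr1.
Qed.

(** Interpolate [P b - P a]: at the nodes [P a] vanishes, the leading terms cancel, and the next
    coefficient is the difference of the root sums. *)
Lemma sum_lagrange_diff (F : fieldType) (T : eqType) (s : seq T) (a b : T -> F) :
  uniq s -> {in s &, injective a} ->
  \sum_(x <- s) (\prod_(y <- s) (a x - b y)) / \prod_(y <- s | y != x) (a x - a y)
    = \sum_(x <- s) (a x - b x).
Proof.
move=> us ia; have [->|sn0] := eqVneq s [::]; first by rewrite !big_nil.
have sz0 : (0 < size s)%N by case: (s) sn0.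
pose P (c : T -> F) : {poly F} := \prod_(y <- s) ('X - (c y)%:P).
have PE c : P c = \prod_(z <- map c s) ('X - z%:P) by rewrite big_map.
have sP c : size (P c) = (size s).+1 by rewrite PE size_prod_XsubC size_map.
have P1 c : (P c)`_(size s) = 1.
  by have /monicP := monic_prod_XsubC s predT c; rewrite /lead_coef sP.
have P2 c : (P c)`_(size s).-1 = - \sum_(x <- s) c x.
  by rewrite PE -(size_map c) coefPn_prod_XsubC ?size_map -?lt0n // big_map.
transitivity (\sum_(x <- s) (P b - P a).[a x] / \prod_(y <- s | y != x) (a x - a y)).
  apply: eq_big_seq => x xs; congr (_ / _); rewrite !hornerE !horner_prod.
  rewrite [X in _ - X](bigD1_seq x) //= hornerXsubC subrr mul0r subr0.
  by apply: eq_bigr => y _; rewrite hornerXsubC.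
rewrite sum_lagrange_coef //.
  by rewrite coefB !P2 opprK addrC sumrB.
apply/leq_sizeP => j; rewrite leq_eqVlt => /orP[/eqP <-|lj].
  by rewrite coefB !P1 subrr.
by rewrite coefB !nth_default ?subrr // sP.
Qed.

(** * Schur's product formula *)

Definition phi (x y : nat) : rat := (x%:R - y%:R) / (x%:R + y%:R).

Lemma phiC x y : phi x y = - phi y x.
Proof. by rewrite /phi -mulNr opprB [y%:R + x%:R]addrC. Qed.

Lemma phi0 x : (0 < x)%N -> phi x 0 = 1.
Proof. by move=> x0; rewrite /phi subr0 divff // pnatr_eq0 -lt0n. Qed.

Fixpoint phi_pairs (la : seq nat) : rat :=
  if la is x :: l then (\prod_(y <- l) phi x y) * phi_pairs l else 1.

Lemma phi_pairs_cat l1 l2 :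
  phi_pairs (l1 ++ l2)
    = phi_pairs l1 * phi_pairs l2 * \prod_(y <- l2) \prod_(x <- l1) phi x y.
Proof.
rewrite exchange_big /=; elim: l1 => [|x l IH] /=; first by rewrite big_nil mulr1 mul1r.
by rewrite IH big_cat big_cons /=; ring.
Qed.

(** By antisymmetry each entry before q costs a sign. The sign depends only on the place of q, so it
    cancels when q is replaced by another value. *)
Lemma phi_pairs_insert l1 q l2 :
  phi_pairs (l1 ++ q :: l2)
    = (-1) ^+ size l1 * phi_pairs (l1 ++ l2) * \prod_(y <- l1 ++ l2) phi q y.
Proof.
elim: l1 => [|x l IH] /=; first by rewrite !mul1r mulrC.
by rewrite IH !(big_cat, big_cons) /= (phiC x q) exprS; ring.
Qed.

Lemma phi_pairs_filter_gt0 l : sorted gtn l ->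
  phi_pairs [seq x <- l | 0 < x]%N = phi_pairs l.
Proof.
elim: l => // x l IH /= pth; have sl := path_sorted pth.
case: ltnP => [x0 /=|]; last first.
  rewrite leqn0 => /eqP x0; move: pth; rewrite x0.
  by case: (l) => [|y k]; rewrite //= big_nil mulr1.
rewrite IH // big_filter big_mkcond; congr (_ * _); apply: eq_bigr => y _.
by case: ltnP => //; rewrite leqn0 => /eqP ->; rewrite phi0.
Qed.

Definition schur (la : seq nat) : rat :=
  (sumn la)`!%:R / (\prod_(x <- la) x`!)%N%:R * phi_pairs la.

Lemma prod_fact_neq0 (la : seq nat) : (\prod_(x <- la) x`!)%N%:R != 0 :> rat.
Proof.
rewrite pnatr_eq0 -lt0n; elim: la => [|x l IH]; first by rewrite big_nil.
by rewrite big_cons muln_gt0 fact_gt0.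
Qed.

(** Only the factors involving p change: the factorials lose [sumn la] and p, and each [phi p y]
    becomes [phi p.-1 y] up to a sign that cancels. *)
Lemma schur_decr la p : strict_partition la -> p \in la -> p.-1 \notin la ->
  schur (decr p la)
    = schur la / (sumn la)%:R * (p%:R * \prod_(y <- la | y != p) (phi p.-1 y / phi p y)).
Proof.
move=> sla pl npl; have sn := sumn_decr sla pl; have p0 := strict_partition_gt0 sla pl.
have ula := strict_partition_uniq sla; have sm := map_decr_sorted sla npl.
have [l1 [l2 [E rE]]] : exists l1 l2, la = l1 ++ p :: l2 /\ rem p la = l1 ++ l2.
  case/splitPr: pl ula {sla npl sn sm} => l1 l2 ula; exists l1, l2; split=> //.
  move: ula; rewrite remE cat_uniq /= negb_or => /and3P[_ /andP[pl1 _] _].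
  rewrite index_cat (negPf pl1) /= eqxx addn0 take_size_cat //.
  by rewrite drop_cat ltnNge leqnSn /= subSnn /= drop0.
have prodr (f : nat -> rat) : \prod_(y <- la | y != p) f y = \prod_(y <- l1 ++ l2) f y.
  by rewrite -rE -big_filter -rem_filter.
have notp y : y \in l1 ++ l2 -> y != p.
  by rewrite -rE (mem_rem_uniq _ ula) inE => /andP[].
have mE : [seq if x == p then p.-1 else x | x <- la] = l1 ++ p.-1 :: l2.
  rewrite E map_cat /= eqxx; congr (_ ++ _ :: _); rewrite -[RHS]map_id;
    apply/eq_in_map => y yl; rewrite (negPf (notp y _)) // mem_cat yl ?orbT //.
have nz : \prod_(y <- l1 ++ l2) phi p y != 0.
  rewrite prodf_seq_neq0; apply/allP => y yl /=; rewrite /phi mulf_neq0 //.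
    by rewrite subr_eq0 eqr_nat eq_sym notp.
  by rewrite invr_eq0 -natrD pnatr_eq0 -lt0n addn_gt0 p0.
have fE : (\prod_(x <- la) x`! = p * \prod_(x <- decr p la) x`!)%N.
  rewrite /decr mE big_filter [in RHS]big_mkcond /=.
  (* A dropped zero would contribute 0! = 1. *)
  rewrite [in RHS](eq_bigr (fun x => x`!)); last by move=> x _; case: x.
  rewrite E !big_cat !big_cons /= -{1}(prednK p0) factS prednK //.
  by rewrite -mulnA mulnCA.
have pE : phi_pairs (decr p la)
    = phi_pairs la * \prod_(y <- la | y != p) (phi p.-1 y / phi p y).
  rewrite /decr phi_pairs_filter_gt0 // mE {1}E !phi_pairs_insert prodr.
  by rewrite [X in _ = _ * X]prodf_div; field; exact: nz.
rewrite /schur pE fE natrM [in (sumn la)`!]sn factS -sn natrM.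
have := prod_fact_neq0 (decr p la).
have : p%:R != 0 :> rat by rewrite pnatr_eq0 -lt0n.
have : (sumn la)%:R != 0 :> rat by rewrite sn pnatr_eq0.
move=> h1 h2 h3; field; by rewrite h1 h2 h3.
Qed.

(* With a x = x (x - 1) and b x = x (x + 1), the summand is the one of
   [sum_lagrange_diff] up to the factor a p - b p = - 2 p. *)
Lemma sum_phi_ratio la : strict_partition la ->
  \sum_(p <- la) p%:R * \prod_(y <- la | y != p) (phi p.-1 y / phi p y) = (sumn la)%:R.
Proof.
move=> sla; have ula := strict_partition_uniq sla.
pose a (x : nat) : rat := x%:R * (x%:R - 1).
pose b (x : nat) : rat := x%:R * (x%:R + 1).
have aB x y : a x - a y = (x%:R - y%:R) * (x%:R + y%:R - 1) by rewrite /a; ring.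
have la1 x : x \in la -> 1 <= x%:R :> rat.
  by move=> xl; rewrite ler1n (strict_partition_gt0 sla xl).
have neq x y : x \in la -> y \in la -> x != y -> a x - a y != 0.
  move=> xl yl xy; rewrite aB mulf_neq0 // ?subr_eq0 ?eqr_nat //.
  by apply/eqP; have := la1 x xl; have := la1 y yl; lra.
have ia : {in la &, injective a}.
  move=> x y xl yl e; apply/eqP; apply: contraTT (eqxx (a x)) => /(neq x y xl yl).
  by rewrite e subrr eqxx.
have := sum_lagrange_diff b ula ia.
rewrite [RHS](eq_bigr (fun x : nat => -2 * x%:R)); last by move=> x _; rewrite /a /b; ring.
rewrite -mulr_sumr -natr_sum -sumnE => L.
apply: (@mulfI _ (-2)) => //; rewrite -L mulr_sumr; apply: eq_big_seq => p pl.
rewrite [in RHS](bigD1_seq p) //= mulrA -[RHS]mulrA -prodf_div; congr (_ * _).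
  by rewrite /a /b; ring.
rewrite big_seq_cond [RHS]big_seq_cond; apply: eq_bigr => y /andP[yl yp].
have := neq p y pl yl; rewrite eq_sym yp => /(_ isT); rewrite aB mulf_eq0 negb_or => /andP[n1 n2].
have p0 := strict_partition_gt0 sla pl.
have n3 : p%:R + y%:R != 0 :> rat by rewrite -natrD pnatr_eq0 -lt0n addn_gt0 p0.
(* The match rests on a p - b y = (p + y)(p - y - 1) and a p - a y = (p - y)(p + y - 1). *)
have -> : phi p.-1 y = (p%:R - 1 - y%:R) / (p%:R + y%:R - 1).
  by rewrite /phi -[in RHS](prednK p0) -addn1 natrD; congr (_ / _); ring.
rewrite /phi /a /b; field.
by rewrite n1 n2 n3.
Qed.

Lemma g_schur la : strict_partition la -> (g la)%:R = schur la.
Proof.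
have [n] := ubnP (sumn la); elim: n la => // n IH la; rewrite ltnS => lan sla.
have [->|la0] := eqVneq la [::].
  by rewrite g_nil /schur big_nil /= divr1 mulr1.
have sn0 : (sumn la)%:R != 0 :> rat.
  rewrite pnatr_eq0 -lt0n; case: (la) la0 sla => // x l _ sla.
  by rewrite addn_gt0 (strict_partition_gt0 sla) ?mem_head.
rewrite g_rec // natr_sum.
transitivity (\sum_(p <- la)
    schur la / (sumn la)%:R * (p%:R * \prod_(y <- la | y != p) (phi p.-1 y / phi p y))).
  rewrite big_mkcond; apply: eq_big_seq => p pl; case: ifPn => [npl|/negPn npl].
    rewrite IH ?schur_decr //; last exact: strict_partition_decr.
    by move: lan; rewrite (sumn_decr sla pl).
  (* If p - 1 is a part, its factor [phi p.-1 p.-1] is 0, so the sum may run over all parts. *)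
  rewrite (big_rem p.-1) //= ifT; last first.
    by have := strict_partition_gt0 sla pl; case: (p) => // k _; rewrite neq_ltn ltnSn.
  by rewrite /phi subrr !mul0r !mulr0.
by rewrite -mulr_sumr sum_phi_ratio // divfK.
Qed.

(** * Unions of partitions and the final sum *)

(** In Schur's formula the pairs lie within mu, within la or across; the factorials of the sizes
    combine into the binomial. *)
Lemma g_cat mu la : strict_partition (mu ++ la) ->
  (g (mu ++ la))%:R = (g mu)%:R * (g la)%:R * 'C(sumn mu + sumn la, sumn mu)%:R
    * \prod_(y <- la) \prod_(x <- mu) phi x y.
Proof.
move=> s; have [sm sl] : strict_partition mu /\ strict_partition la.
  move: s; rewrite /strict_partition all_cat => /andP[sc /andP[-> ->]].
  rewrite !andbT; split.
    exact: (subseq_sorted gtn_trans (prefix_subseq mu la) sc).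
  exact: (subseq_sorted gtn_trans (suffix_subseq mu la) sc).
rewrite !g_schur // /schur phi_pairs_cat sumn_cat big_cat natrM.
have /(congr1 (fun k => k%:R : rat)) := @bin_fact (sumn mu + sumn la) (sumn mu) (leq_addr _ _).
rewrite addKn !natrM => <-.
have := prod_fact_neq0 mu; have := prod_fact_neq0 la => h1 h2.
by field; rewrite h1 h2.
Qed.

Lemma prod_set_parts_setC m (A : {set 'I_m}) (f : nat -> rat) :
  (\prod_(y <- set_parts A) f y) * (\prod_(y <- set_parts (~: A)) f y)
    = \prod_(y <- staircase m) f y.
Proof.
by rewrite -big_cat /=; apply: perm_big; apply: perm_set_parts_setC.
Qed.

(* Every part of mu exceeds m, so the union of mu with a partition whose parts
   are at most m is the concatenation [mu ++ _]. *)
Theorem theorem4p6 (m : nat) (mu : seq nat)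
    (mu_strict : strict_partition mu)
    (mu_gt_m : forall p : nat, p \in mu -> (m < p)%N) :
  let M := 'C(m.+1, 2) in
  let N := sumn mu in
  (\sum_(s : m.-bseq 'I_m.+1 | strict_partition (parts s))
      g (mu ++ parts s) * g (mu ++ compl_parts m (parts s)))%N%:R
  = (g (mu ++ staircase m))%:R * (g mu)%:R
    * (((M + 2 * N + 1)`!)%:R * (N`!)%:R)
    / (((M + N)`!)%:R * ((2 * N + 1)`!)%:R) :> rat.
Proof.

move=> M N; set F := fun la => (g (mu ++ la) * g (mu ++ compl_parts m la))%N.
rewrite (@sum_bseq_set_parts m F) {}/F natr_sum.
(* The cross factors of a set of parts and of its complement multiply to [Psi], whatever the set. *)
pose Psi : rat := \prod_(y <- staircase m) \prod_(x <- mu) phi x y.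
have scat la : strict_partition la -> all (leq^~ m) la -> strict_partition (mu ++ la).
  move=> /andP[sl al] /allP lm; move: mu_strict => /andP[smu amu].
  rewrite /strict_partition all_cat amu al !andbT.
  rewrite sorted_pairwise ?pairwise_cat -?sorted_pairwise ?smu ?sl ?andbT; try exact: gtn_trans.
  by apply/allrelP => x y /mu_gt_m mx /lm ym /=; apply: leq_ltn_trans mx.
have lem (A : {set 'I_m}) : all (leq^~ m) (set_parts A).
  by apply/allP=> p /set_partsP[i _ ->].
have spA (A : {set 'I_m}) := strict_partition_set_parts A.
have gA (A : {set 'I_m}) :
    (g (mu ++ set_parts A) * g (mu ++ compl_parts m (set_parts A)))%N%:R
      = (g mu)%:R ^+ 2 * Psi *
        ('C(N + weight A, N) * 'C(N + (M - weight A), N) *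
           (g (set_parts A) * g (set_parts (~: A))))%N%:R.
  rewrite compl_set_parts natrM !g_cat ?scat //.
  rewrite -/(weight A) -/(weight (~: A)) -/N /M -(weight_setC A) addKn.
  by rewrite /Psi -(prod_set_parts_setC A) !natrM; ring.
rewrite (eq_bigr _ (fun A _ => gA A)) -mulr_sumr -natr_sum.
have -> : (\sum_(A : {set 'I_m}) 'C(N + weight A, N) * 'C(N + (M - weight A), N) *
    (g (set_parts A) * g (set_parts (~: A))))%N
    = ('C(M + 2 * N + 1, M) * g (staircase m))%N.
  have wM (A : {set 'I_m}) : (weight A < M.+1)%N.
    by rewrite ltnS /M -(weight_setC A) leq_addr.
  (* Within one weight the binomials are constant and [sum_g_set_parts] evaluates the rest. *)
  rewrite (partition_big (fun A => Ordinal (wM A)) predT) //=.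
  have -> : (M + 2 * N + 1 = N + N + M.+1)%N by lia.
  rewrite -sum_bin_bin big_distrl; apply: eq_bigr => s _ /=.
  have sM : (s <= M)%N by rewrite -ltnS ltn_ord.
  rewrite -(sum_g_set_parts sM) big_distrr /=.
  apply: eq_big => [A|A /eqP <-]; first exact: (val_eqE (Ordinal (wM A)) s).
  reflexivity.
(* Factoring the right side in the same way produces [Psi] there too, and only factorials remain to
   compare. *)
rewrite g_cat; last first.
  by rewrite -set_partsT; apply: scat.
rewrite sumn_staircase -/M -/N -/Psi natrM.
have f1 := @bin_fact (M + 2 * N + 1) M (ltac:(lia)).
have f2 := @bin_fact (N + M) N (leq_addr _ _).
rewrite addKn in f2; rewrite -f1 [(M + N)%N]addnC -f2.
have -> : (M + 2 * N + 1 - M = 2 * N + 1)%N by lia.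
have nf k : k`!%:R != 0 :> rat by rewrite pnatr_eq0 -lt0n fact_gt0.
have nb : 'C(N + M, N)%:R != 0 :> rat by rewrite pnatr_eq0 -lt0n bin_gt0 leq_addr.
rewrite !natrM; have := nf N; have := nf M; have := nf (2 * N + 1)%N.
by move=> h1 h2 h3; field; rewrite nb h1 h2 h3.
Qed.
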